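(* There is a universal constant $A>0$ such that the following holds. Let $p\ge 2$ and let $(X,\|\cdot\|)$ be a Banach space for which there exists $K>0$ such that $$\forall x,y\in X,\quad \left\|\frac{x+y}{2}\right\|^p\le \frac{\|x\|^p+\|y\|^p}{2}-\frac{1}{K^p}\left\|\frac{x-y}{2}\right\|^p.$$ Let $f:\mathbb{H}\to X$ be a $1$-Lipschitz function (with respect to $d_W$). Then for every $t\ge 3$ there exists an integer $n$ with $t\le n\le t^2$ such that $$\frac{\omega_f(n)}{n}\le A\, K_p(X)\left(\frac{\log\log n}{\log n}\right)^{1/p}.$$
   Context: $\mathbb{H}=\langle a,b \mid aba^{-1}b^{-1}\text{ is central}\rangle$ is the discrete Heisenberg group, and $d_W$ is the left-invariant word metric on $\mathbb{H}$ associated to the symmetric generating set $S=\{a,b,a^{-1},b^{-1}\}$. $K_p(X)$ denotes the infimum over those $K>0$ for which the displayed convexity inequality in the claim holds for all $x,y\in X$. For a Lipschitz function $f:\mathbb{H}\to X$, the compression rate $\omega_f$ is the largest function $\omega_f:(0,\infty)\to[0,\infty)$ such that $\|f(x)-f(y)\|\ge \omega_f(d_W(x,y))$ for all $x,y\in\mathbb{H}$; thus for an integer $n\ge1$, $\omega_f(n)=\inf\{\|f(x)-f(y)\|: x,y\in\mathbb{H},\ d_W(x,y)=n\}$. *)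

(* Defs.v *)
From HB Require Import structures.
From mathcomp Require Import all_boot all_order all_algebra.
From mathcomp Require Import all_classical all_reals all_analysis.
Import Order.TTheory GRing.Theory Num.Theory.
Import numFieldNormedType.Exports.

Set Implicit Arguments.
Unset Strict Implicit.
Unset Printing Implicit Defensive.

(* [(false, e)] stands for [a] and [(true, e)] for [b]; the letter is inverted
   when [e] is true. *)
Definition letter : Type := (bool * bool)%type.
Definition word : Type := seq letter.

Definition letterV (l : letter) : letter := (l.1, ~~ l.2).
Definition wordV (w : word) : word := rev (map letterV w).

Definition letter_a : letter := (false, false).
Definition letter_b : letter := (true, false).
Definition commutator_ab : word :=
  [:: letter_a; letter_b; letterV letter_a; letterV letter_b].

(* The least congruence on words that cancels [l l^-1] (so that the quotient is
   a group) and makes [a b a^-1 b^-1] commute with every letter. *)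
Inductive heis_rel : word -> word -> Prop :=
| heis_refl u : heis_rel u u
| heis_sym u v : heis_rel u v -> heis_rel v u
| heis_trans v u w : heis_rel u v -> heis_rel v w -> heis_rel u w
| heis_cat u u' v v' :
    heis_rel u u' -> heis_rel v v' -> heis_rel (u ++ v) (u' ++ v')
| heis_cancel l : heis_rel [:: l; letterV l] [::]
| heis_central l : heis_rel (commutator_ab ++ [:: l]) (l :: commutator_ab).

Definition heis_relb (u v : word) : bool := `[< heis_rel u v >].

Lemma heis_relb_refl : reflexive heis_relb.
Proof. by move=> u; apply/asboolP; exact: heis_refl. Qed.

Lemma heis_relb_sym : symmetric heis_relb.
Proof. by move=> u v; apply/asboolP/asboolP; exact: heis_sym. Qed.

Lemma heis_relb_trans : transitive heis_relb.
Proof.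
move=> v u w /asboolP uv /asboolP vw; apply/asboolP; exact: heis_trans uv vw.
Qed.

Canonical heis_equiv :=
  EquivRel heis_relb heis_relb_refl heis_relb_sym heis_relb_trans.

(* The discrete Heisenberg group [<a, b | a b a^-1 b^-1 is central>]. *)
Definition heis : Type := {eq_quot heis_equiv}%qT.
HB.instance Definition _ := Choice.on heis.
HB.instance Definition _ := EqQuotient.on heis.

Definition heis_of (w : word) : heis := (\pi_heis w)%qT.

Lemma heis_ofP (u v : word) : heis_of u = heis_of v <-> heis_rel u v.
Proof.
split=> [/eqquotP /asboolP //|uv].
by apply/eqquotP/asboolP.
Qed.

Lemma heis_reprK (x : heis) : heis_of (repr x) = x.
Proof. exact: reprK. Qed.

Lemma letterVK : involutive letterV.
Proof. by case=> g e; rewrite /letterV /= negbK. Qed.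

Lemma wordVK : involutive wordV.
Proof.
by move=> w; rewrite /wordV map_rev revK -map_comp (eq_map letterVK) map_id.
Qed.

Lemma heis_rel_wordVr (w : word) : heis_rel (w ++ wordV w) [::].
Proof.
elim: w => [|l w IH]; first exact: heis_refl.
have -> : (l :: w) ++ wordV (l :: w) = [:: l] ++ (w ++ wordV w) ++ [:: letterV l].
  by rewrite /wordV /= rev_cons -cats1 catA.
apply: heis_trans (heis_cancel l).
apply: (heis_cat (heis_refl [:: l])).
exact: (heis_cat IH (heis_refl [:: letterV l])).
Qed.

Lemma heis_rel_wordVl (w : word) : heis_rel (wordV w ++ w) [::].
Proof. by rewrite -{2}(wordVK w); exact: heis_rel_wordVr. Qed.

Lemma heis_rel_wordV (u v : word) :
  heis_rel u v -> heis_rel (wordV u) (wordV v).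
Proof.
move=> uv.
have h1 : heis_rel (wordV u) (wordV u ++ (v ++ wordV v)).
  rewrite -{1}(cats0 (wordV u)); apply: heis_cat; first exact: heis_refl.
  exact/heis_sym/heis_rel_wordVr.
apply: (heis_trans h1); rewrite catA.
apply: (@heis_trans ([::] ++ wordV v)); last exact: heis_refl.
apply: heis_cat; last exact: heis_refl.
apply: heis_trans (heis_rel_wordVl u).
by apply: heis_cat; [exact: heis_refl|exact: heis_sym].
Qed.

Definition heis_mul (x y : heis) : heis := heis_of (repr x ++ repr y).
Definition heis_one : heis := heis_of [::].
Definition heis_inv (x : heis) : heis := heis_of (wordV (repr x)).

Lemma heis_repr_rel (w : word) : heis_rel (repr (heis_of w)) w.
Proof. by apply/heis_ofP; rewrite heis_reprK. Qed.

Lemma heis_mulE (u v : word) :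
  heis_mul (heis_of u) (heis_of v) = heis_of (u ++ v).
Proof. by apply/heis_ofP/heis_cat; exact: heis_repr_rel. Qed.

Lemma heis_invE (u : word) : heis_inv (heis_of u) = heis_of (wordV u).
Proof. by apply/heis_ofP/heis_rel_wordV; exact: heis_repr_rel. Qed.

Lemma heis_mulA : associative heis_mul.
Proof.
move=> x y z; rewrite -(heis_reprK x) -(heis_reprK y) -(heis_reprK z).
by rewrite !heis_mulE catA.
Qed.

Lemma heis_mul1 : left_id heis_one heis_mul.
Proof. by move=> x; rewrite -(heis_reprK x) heis_mulE. Qed.

Lemma heis_1mul : right_id heis_one heis_mul.
Proof. by move=> x; rewrite -(heis_reprK x) heis_mulE cats0. Qed.

Lemma heis_mulV : left_inverse heis_one heis_inv heis_mul.
Proof.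
move=> x; rewrite -(heis_reprK x) heis_invE heis_mulE.
exact/heis_ofP/heis_rel_wordVl.
Qed.

Lemma heis_Vmul : right_inverse heis_one heis_inv heis_mul.
Proof.
move=> x; rewrite -(heis_reprK x) heis_invE heis_mulE.
exact/heis_ofP/heis_rel_wordVr.
Qed.

HB.instance Definition _ :=
  isGroup.Build heis heis_mulA heis_mul1 heis_1mul heis_mulV heis_Vmul.

Lemma heis_of_cat (u v : word) : heis_of (u ++ v) = (heis_of u * heis_of v)%g.
Proof. by rewrite -heis_mulE. Qed.

Lemma heis_ofV (u : word) : heis_of (wordV u) = (heis_of u)^-1%g.
Proof. by rewrite -heis_invE. Qed.

Definition heis_a : heis := heis_of [:: letter_a].
Definition heis_b : heis := heis_of [:: letter_b].

Definition heis_gens : seq heis :=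
  [:: heis_a; heis_b; heis_a^-1; heis_b^-1]%g.

Definition gens_product (n : nat) (x : heis) : Prop :=
  exists s : seq heis,
    [/\ size s = n, {subset s <= heis_gens} & (\prod_(g <- s) g)%g = x].

Lemma heis_generated (x : heis) : exists n, `[< gens_product n x >].
Proof.
exists (size (repr x)); apply/asboolP.
exists (map (fun l => heis_of [:: l]) (repr x)); split.
- by rewrite size_map.
- move=> _ /mapP[[[] []] _ ->]; rewrite !inE -!heis_ofV.
  + by rewrite eqxx !orbT.
  + by rewrite eqxx orbT.
  + by rewrite eqxx !orbT.
  + by rewrite eqxx.
- rewrite big_map -[RHS]heis_reprK.
  elim: (repr x) => [|l w IH]; first by rewrite big_nil.
  by rewrite big_cons IH -heis_of_cat.
Qed.

Definition word_length (x : heis) : nat := ex_minn (heis_generated x).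

Definition dW (x y : heis) : nat := word_length (x^-1 * y)%g.

Local Open Scope classical_set_scope.
Local Open Scope ring_scope.

Section Convexity.
Variables (R : realType) (p : R) (X : normedModType R).

Definition uniformly_p_convex (K : R) : Prop :=
  forall x y : X,
    `|2^-1 *: (x + y)| `^ p <=
    (`|x| `^ p + `|y| `^ p) / 2 - (K `^ p)^-1 * `|2^-1 *: (x - y)| `^ p.

(* The infimum is taken over positive [K] only, so the set is bounded below. *)
Definition Kp : R := inf [set K : R | 0 < K /\ uniformly_p_convex K].

End Convexity.

Section Compression.
Variables (R : realType) (X : normedModType R) (f : heis -> X).

Definition lipschitz1 : Prop :=
  forall x y : heis, `|f x - f y| <= (dW x y)%:R.

(* Value at the integer [n] of the largest [w] such that
   [`|f x - f y| >= w (dW x y)] for all [x], [y]; [dW] only takes integer values.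
   The set is nonempty for every [n], since the group is infinite. *)
Definition compression_rate (n : nat) : R :=
  inf [set r : R | exists x y : heis, dW x y = n /\ r = `|f x - f y|].

End Compression.

(* Main.v *)
Require Import Defs.
From mathcomp Require Import all_boot all_order all_algebra.
From mathcomp Require Import all_classical all_reals all_analysis.
From mathcomp Require Import zify ring lra.
Import Order.TTheory GRing.Theory Num.Theory.
Import numFieldNormedType.Exports.
Local Open Scope ring_scope.
Set Implicit Arguments.
Unset Strict Implicit.
Unset Printing Implicit Defensive.

(** The centre of the Heisenberg group is quadratically distorted: with
    [c = a b a^-1 b^-1], the element [c ^ (n ^ 2)] is the commutator of [a ^ n] and
    [b ^ n], and its word length lies between [n] and [4 n]. It is therefore enough
    to find, at some scale [n], points [y] for which [f (y c ^ (n ^ 2)) - f y] is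
    small compared to [n].

    Let [h_N x] be the average of [f (x c ^ l)] over [l < N]. Since [c] is central,
    this averaging commutes with right translations. If [N = u ^ 2] then [h_N] is
    within [6 u] of [f] (lemma [smooth_close]), because [c ^ l] has length [O(u)]
    for [l < N]. If [N' = (D ^ 2 u) ^ 2] then [h_N'] is nearly invariant under
    [c ^ (n ^ 2)] for [n = D u] (lemma [smooth_shift]), because two long windows
    that differ by a short shift almost coincide. So if [h_N] and [h_N'] were equal,
    [c ^ (n ^ 2)] would displace [f] by [O(u) = O(n / D)] only.

    They are compared through their increments. Fix an invariant mean [M] on the
    bounded functions on the group ([heis_invariant_mean]). For any
    pseudodistance, the mean displacement of a point by [g] is a length function of
    [g], so that of the commutator is at most [2 n] times the sum of those of [a]
    and [b] ([displacement_cX]). The increment of [h_N'] along a generator is an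
    average of translates of the increment of [h_N]; uniform convexity bounds the
    distance of the terms from their average by the loss in the mean [p]-th power
    ([uniform_convexity_defect]), that is, by the drop of an energy between the two
    window lengths ([energy_drop]). This is [one_scale].

    The energies decrease with the window length and lie in [[0, 1]], so among [J]
    successive scales with ratio [D ^ 2] there is one where they drop by at most
    [2 / J] ([multi_scale]). With [D] of order [ln t] there is room between [t] and
    [t ^ 2] for [J] of order [ln t / ln (ln t)] scales ([scale_parameters]), and the
    resulting bound is [O(1 / D + K / J ^ (1 / p))], which is the claim. When [ln t]
    is bounded, the claim reduces to [1 <= K], true in every nonzero space. *)

(** * The group: central powers as commutators *)

Definition heis_c : heis := heis_of commutator_ab.

Lemma heis_genP (P : heis -> Prop) :
    P heis_a -> P heis_b -> (forall x y, P x -> P y -> P (x * y)%g) ->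
    (forall x, P x -> P x^-1%g) ->
  forall x, P x.
Proof.
move=> Pa Pb PM PV x; rewrite -(heis_reprK x).
elim: (repr x) => [|[[] []] w IH].
- by have := PM _ _ Pa (PV _ Pa); rewrite mulgV.
- by rewrite -cat1s heis_of_cat; apply: PM => //; have := PV _ Pb; rewrite -heis_ofV.
- by rewrite -cat1s heis_of_cat; apply: PM.
- by rewrite -cat1s heis_of_cat; apply: PM => //; have := PV _ Pa; rewrite -heis_ofV.
- by rewrite -cat1s heis_of_cat; apply: PM.
Qed.

Lemma heis_c_central x : commute heis_c x.
Proof.
elim/heis_genP: x.
- by rewrite /commute -!heis_of_cat; exact/heis_ofP/heis_central.
- by rewrite /commute -!heis_of_cat; exact/heis_ofP/heis_central.
- by move=> x y cx cy; apply: (commuteM cx cy).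
- by move=> x cx; apply: (commuteV cx).
Qed.

Lemma heis_cX_central n x : (heis_c ^+ n * x = x * heis_c ^+ n)%g.
Proof. by apply/commute_sym/commuteX/commute_sym; apply: heis_c_central. Qed.

Lemma heis_abE : (heis_a * heis_b = heis_c * (heis_b * heis_a))%g.
Proof.
have -> : heis_c = (heis_a * heis_b * heis_a^-1 * heis_b^-1)%g.
  rewrite /heis_c -[commutator_ab]/([:: letter_a] ++ [:: letter_b] ++
    wordV [:: letter_a] ++ wordV [:: letter_b]).
  by rewrite !heis_of_cat !heis_ofV !mulgA.
by rewrite -!mulgA mulKg mulVg mulg1.
Qed.

Lemma heis_aXbE i : (heis_a ^+ i * heis_b = heis_c ^+ i * (heis_b * heis_a ^+ i))%g.
Proof.
elim: i => [|i IH]; first by rewrite !expg0 !mul1g mulg1.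
rewrite expgS -mulgA IH mulgA -heis_cX_central -mulgA (mulgA heis_a) heis_abE.
by rewrite !mulgA -expgSr -!mulgA -expgS.
Qed.

(** In a group of nilpotency class two the commutator is bilinear; this is what
    makes the centre quadratically distorted. *)
Lemma heis_cX_comm i j :
  (heis_c ^+ (i * j) =
   heis_a ^+ i * heis_b ^+ j * (heis_a ^+ i)^-1 * (heis_b ^+ j)^-1)%g.
Proof.
suff E : (heis_a ^+ i * heis_b ^+ j = heis_c ^+ (i * j) * (heis_b ^+ j * heis_a ^+ i))%g.
  by rewrite E -!mulgA (mulgA _ _ (heis_b ^+ j)^-1)%g mulgV mul1g mulgV mulg1.
elim: j => [|j IH]; first by rewrite muln0 !expg0 !mul1g mulg1.
rewrite (expgSr heis_b) mulgA IH -!mulgA heis_aXbE mulnSr expgnDr -!mulgA.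
by congr (_ * _)%g; rewrite [LHS]mulgA [RHS]mulgA (heis_cX_central i).
Qed.

(** * Word lengths *)

Lemma word_length_le n x : gens_product n x -> (word_length x <= n)%N.
Proof. by move=> ?; rewrite /word_length; case: ex_minnP => m _; apply; apply/asboolP. Qed.

Lemma gens_product_length x : gens_product (word_length x) x.
Proof. by rewrite /word_length; case: ex_minnP => m /asboolP. Qed.

Lemma word_lengthM x y : (word_length (x * y)%g <= word_length x + word_length y)%N.
Proof.
have [s [<- sg <-]] := gens_product_length x.
have [s' [<- sg' <-]] := gens_product_length y.
apply: word_length_le; exists (s ++ s'); split; first by rewrite size_cat.
- by move=> g; rewrite mem_cat => /orP[/sg|/sg'].
- by rewrite big_cat.
Qed.

Lemma word_length_gen x : x \in heis_gens -> (word_length x <= 1)%N.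
Proof.
move=> xg; apply: word_length_le; exists [:: x]; split => //.
- by move=> y; rewrite inE => /eqP ->.
- by rewrite big_seq1.
Qed.

Lemma word_length1 : word_length 1%g = 0.
Proof.
apply/eqP; rewrite -leqn0; apply: word_length_le.
by exists [::]; split; rewrite ?big_nil.
Qed.

Lemma word_lengthX x n : (word_length (x ^+ n)%g <= n * word_length x)%N.
Proof.
elim: n => [|n IH]; first by rewrite expg0 word_length1.
by rewrite expgS mulSn (leq_trans (word_lengthM _ _)) ?leq_add2l.
Qed.

Lemma word_length_cX i j : (word_length (heis_c ^+ (i * j))%g <= 2 * (i + j))%N.
Proof.
have gX x n : x \in heis_gens -> (word_length (x ^+ n)%g <= n)%N.
  move=> /word_length_gen xg.
  by rewrite (leq_trans (word_lengthX _ _)) // -[leqRHS]muln1 leq_mul2l xg orbT.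
rewrite heis_cX_comm -!expVgn (_ : 2 * (i + j) = i + j + i + j)%N; last lia.
by do 3?[apply: leq_trans (word_lengthM _ _) (leq_add _ _)];
  apply: gX; rewrite !inE eqxx ?orbT.
Qed.

(** Write [l = q * u + r] with [q, r < u]: both [c ^ (q * u)] and [c ^ r] are
    commutators of short powers. *)
Lemma word_length_cX_small u l : (l < u * u)%N ->
  (word_length (heis_c ^+ l)%g <= 6 * u)%N.
Proof.
move=> lu; have u0 : (0 < u)%N by lia.
rewrite (divn_eq l u) expgnDr.
apply: leq_trans (word_lengthM _ _) _.
have := word_length_cX (l %/ u) u; have := word_length_cX (l %% u) 1.
rewrite muln1 => h1 h2; apply: leq_trans (leq_add h2 h1) _.
have := ltn_pmod l u0.
have : (l %/ u < u)%N by rewrite ltn_divLR.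
lia.
Qed.

(** The letter-by-letter action on the coordinates [(x, y, z)] of
    [c ^ z b ^ y a ^ x]. *)
Definition coord_step (v : int * int * int) (l : letter) : int * int * int :=
  let: (x, y, z) := v in
  match l with
  | (false, e) => (x + (-1) ^+ e, y, z)
  | (true, e) => (x, y + (-1) ^+ e, z + (-1) ^+ e * x)
  end.

Definition coord (w : word) v := foldl coord_step v w.

Lemma coord_cat u w v : coord (u ++ w) v = coord w (coord u v).
Proof. exact: foldl_cat. Qed.

Lemma coord_rel u w : heis_rel u w -> coord u =1 coord w.
Proof.
elim=> {u w} [u|u w _ IH|u w z _ IH1 _ IH2|u u' w w' _ IH1 _ IH2|l|l] v //.
- by rewrite IH1 IH2.
- by rewrite !coord_cat IH1 IH2.
- case: v l => [[x y] z] [[] []] /=; congr (_, _, _);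
    by rewrite ?expr0 ?expr1; ring.
- case: v l => [[x y] z] [[] []] /=; congr (_, _, _);
    by rewrite ?expr0 ?expr1; ring.
Qed.

Lemma coord_of w : coord (repr (heis_of w)) =1 coord w.
Proof. exact/coord_rel/heis_repr_rel. Qed.

Lemma coord_mul (x y : heis) v : coord (repr (x * y : heis)%g) v = coord (repr y) (coord (repr x) v).
Proof.
rewrite (_ : (x * y)%g = heis_of (repr x ++ repr y)); last first.
  by rewrite heis_of_cat !heis_reprK.
by rewrite coord_of coord_cat.
Qed.

Lemma coord_cX n : coord (repr (heis_c ^+ n : heis)%g) (0, 0, 0) = (0, 0, n%:Z).
Proof.
elim: n => [|n IH]; first by rewrite expg0 coord_of.
rewrite expgSr coord_mul IH coord_of /=.
by congr (_, _, _); rewrite ?expr0 ?expr1; lia.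
Qed.

(** The central coordinate is a signed area swept by the word, so it grows at most
    quadratically with the length. *)
Lemma coord_bound s : {subset s <= heis_gens} ->
  let: (x, y, z) := coord (repr (\prod_(g <- s) g : heis)%g) (0, 0, 0) in
  `|x| <= (size s)%:Z /\ `|z| <= (size s)%:Z ^+ 2.
Proof.
elim/last_ind: s => [|s g IH] sg; first by rewrite big_nil coord_of.
rewrite -cats1 big_cat big_seq1 cats1 coord_mul size_rcons.
have /IH : {subset s <= heis_gens}.
  by move=> h hs; apply: sg; rewrite mem_rcons inE hs orbT.
case: (coord _ _) => [[x y] z] [xs zs].
have : g \in heis_gens by apply: sg; rewrite mem_rcons inE eqxx.
have bound (e d : int) : `|e| <= 1 -> `|d| <= 1 ->
    `|x + e| <= (size s).+1%:Z /\ `|z + d * x| <= (size s).+1%:Z ^+ 2.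
  move=> e1 d1; have : `|d * x| <= `|x| by rewrite normrM ler_piMl.
  by move: xs zs; rewrite intS !expr2 => ???; split; nia.
rewrite !inE => /or4P[] /eqP ->; rewrite -?heis_ofV coord_of /= ?expr0 ?expr1.
- by have [//|//|] := bound 1 0; rewrite mul0r addr0.
- by have [//|//|] := bound 0 1; rewrite addr0.
- by have [//|//|] := bound (-1) 0; rewrite mul0r addr0.
- by have [//|//|] := bound 0 (-1); rewrite addr0.
Qed.

Lemma word_length_cX_ge n : (n <= word_length (heis_c ^+ (n * n))%g)%N.
Proof.
have [s [<- sg E]] := gens_product_length (heis_c ^+ (n * n))%g.
have := coord_bound sg; rewrite E coord_cX => -[_].
by rewrite expr2 -PoszM ger0_norm // lez_nat !mulnn leq_sqr.
Qed.

(** * Means and Jensen's inequality *)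

Section Means.
Variable R : realType.

Definition bounded_real (T : Type) (u : T -> R) := exists B : R, forall x, `|u x| <= B.

(** Finitely additive integration: [M] is constrained on bounded functions only. *)
Record is_mean (T : Type) (M : (T -> R) -> R) : Prop := IsMean {
  mean_cst : forall r, M (fun=> r) = r;
  mean_linear : forall r u v, bounded_real u -> bounded_real v ->
    M (fun x => r * u x + v x) = r * M u + M v;
  mean_le : forall u v, bounded_real u -> bounded_real v ->
    (forall x, u x <= v x) -> M u <= M v }.

Lemma bounded_cst T r : bounded_real (fun _ : T => r).
Proof. by exists `|r|. Qed.

Lemma bounded_comp T U (g : T -> U) (u : U -> R) :
  bounded_real u -> bounded_real (fun x => u (g x)).
Proof. by case=> B uB; exists B. Qed.

Lemma bounded_lin T r (u v : T -> R) :
  bounded_real u -> bounded_real v -> bounded_real (fun x => r * u x + v x).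
Proof.
move=> [B uB] [C vC]; exists (`|r| * B + C) => x.
by rewrite (le_trans (ler_normD _ _)) // normrM lerD // ler_wpM2l.
Qed.

Lemma bounded_add T (u v : T -> R) :
  bounded_real u -> bounded_real v -> bounded_real (fun x => u x + v x).
Proof.
move=> [B uB] [C vC]; exists (B + C) => x.
by rewrite (le_trans (ler_normD _ _)) // lerD.
Qed.

Lemma bounded_between T (u : T -> R) (C : R) :
  (forall x, 0 <= u x <= C) -> bounded_real u.
Proof. by move=> uC; exists C => x; case/andP: (uC x) => u0 ?; rewrite ger0_norm. Qed.

Section Theory.
Context (T : Type) (M : (T -> R) -> R).
Hypothesis mM : is_mean M.

Lemma mean_add u v : bounded_real u -> bounded_real v ->
  M (fun x => u x + v x) = M u + M v.
Proof.
move=> bu bv; rewrite -[M u]mul1r -(mean_linear mM) //.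
by congr M; apply/funext => x; rewrite mul1r.
Qed.

Lemma mean_scale r u : bounded_real u -> M (fun x => r * u x) = r * M u.
Proof.
move=> bu; rewrite -[RHS]addr0 -[in RHS](mean_cst mM 0) -(mean_linear mM) //; last first.
  exact: bounded_cst.
by congr M; apply/funext => x; rewrite addr0.
Qed.

Lemma mean_scaleB r u v : bounded_real u -> bounded_real v ->
  M (fun x => r * (u x - v x)) = r * (M u - M v).
Proof.
move=> bu bv; have bv' : bounded_real (fun x => - r * v x).
  by have [B vB] := bv; exists (`|- r| * B) => x; rewrite normrM ler_wpM2l.
rewrite mulrBr -mulNr -(mean_scale (- r)) // -(mean_linear mM) //.
by congr M; apply/funext => x; rewrite mulrBr mulNr.
Qed.

Lemma mean_norm u (B : R) : (forall x, `|u x| <= B) -> `|M u| <= B.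
Proof.
move=> uB; have bu : bounded_real u by exists B.
rewrite ler_norml -{1}(mean_cst mM (- B)) -{2}(mean_cst mM B); apply/andP.
by split; apply: (mean_le mM) => //; try exact: bounded_cst;
  move=> x; have := uB x; rewrite ler_norml => /andP[].
Qed.

Lemma mean_ge0 u : bounded_real u -> (forall x, 0 <= u x) -> 0 <= M u.
Proof.
by move=> bu u0; rewrite -(mean_cst mM 0); apply: (mean_le mM) => //; exact: bounded_cst.
Qed.

End Theory.

(** This is Young's inequality for the product [u * v ^ (p - 1)]. *)
Lemma powR_tangent (p u v : R) : 1 < p -> 0 <= u -> 0 <= v ->
  v `^ p + p * v `^ (p - 1) * (u - v) <= u `^ p.
Proof.
move=> p1 u0 v0; have p0 : 0 < p by lra.
have pB : 0 < p - 1 by lra.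
have := @conjugate_powR R u (v `^ (p - 1)) p (p / (p - 1)) u0 (powR_ge0 _ _) p0.
rewrite divr_gt0 // => /(_ isT); rewrite -powRrM mulrC (mulrC p) mulrA.
rewrite mulrC invf_div.
have -> : (p - 1) * (p - 1)^-1 * p = p by rewrite divff ?mul1r // gt_eqF.
have -> : p^-1 + (p - 1) / p = 1 by field; rewrite gt_eqF.
move=> /(_ erefl) h.
have vp : v * v `^ (p - 1) = v `^ p by rewrite mulr_powRB1.
have {}h : p * (u * v `^ (p - 1)) <= u `^ p + (p - 1) * v `^ p.
  have -> : u `^ p + (p - 1) * v `^ p = p * (u `^ p / p + v `^ p * ((p - 1) / p)).
    by field; rewrite gt_eqF.
  by rewrite ler_pM2l // [u * _]mulrC mulrC in h *.
suff : p * v `^ (p - 1) * (u - v) = p * (u * v `^ (p - 1)) - p * (v * v `^ (p - 1)).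
  by rewrite vp; lra.
ring.
Qed.

(** Jensen's inequality: take the mean of the tangent inequality at [v = M u]. *)
Lemma mean_powR T (M : (T -> R) -> R) (p : R) u : is_mean M -> 1 < p ->
  bounded_real u -> (forall x, 0 <= u x) ->
  (M u) `^ p <= M (fun x => u x `^ p).
Proof.
move=> mM p1 bu u0; have p0 : 0 <= p by lra.
have Mu0 : 0 <= M u by exact: mean_ge0.
pose v (_ : T) := (M u `^ p - p * M u `^ (p - 1) * M u).
have : M (fun x => p * M u `^ (p - 1) * u x + v x) = M u `^ p.
  by rewrite (mean_linear mM) ?(mean_cst mM) //; [rewrite /v; ring|exact: bounded_cst].
move=> <-; apply: (mean_le mM).
- by apply: bounded_lin => //; exact: bounded_cst.
- case: bu => B uB; apply: (@bounded_between _ _ (B `^ p)) => x.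
  rewrite powR_ge0 /= ge0_ler_powR ?nnegrE //; first exact: le_trans (uB x).
  by rewrite -[u x]ger0_norm.
- by move=> x; rewrite /v; have := powR_tangent p1 (u0 x) Mu0; lra.
Qed.

Lemma mean_pair T U (M : (T -> R) -> R) (N : (U -> R) -> R) :
  is_mean M -> is_mean N ->
  is_mean (fun u : T * U -> R => M (fun x => N (fun y => u (x, y)))).
Proof.
move=> mM mN.
have bN (u : T * U -> R) : bounded_real u -> bounded_real (fun x => N (fun y => u (x, y))).
  by case=> B uB; exists B => x; exact: mean_norm.
split=> [r|r u v bu bv|u v bu bv uv].
- by under eq_fun do rewrite (mean_cst mN); rewrite (mean_cst mM).
- rewrite -(mean_linear mM); [|exact: bN..]; congr M; apply/funext => x.
  by rewrite (mean_linear mN) //; exact: bounded_comp.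
- apply: (mean_le mM); [exact: bN..|] => x.
  by apply: (mean_le mN) => //; exact: bounded_comp.
Qed.

Lemma mean_image T U (g : T -> U) (M : (T -> R) -> R) :
  is_mean M -> is_mean (fun u : U -> R => M (fun x => u (g x))).
Proof.
move=> mM; split=> [r|r u v bu bv|u v bu bv uv]; first exact: (mean_cst mM).
- by rewrite (mean_linear mM) //; exact: bounded_comp.
- by apply: (mean_le mM) => //; exact: bounded_comp.
Qed.

Definition avg (n : nat) (u : nat -> R) : R := (\sum_(i < n) u i) / n%:R.

Lemma avg_is_mean n : (0 < n)%N -> is_mean (avg n).
Proof.
move=> n0; have n0' : (n%:R : R) != 0 by rewrite pnatr_eq0 -lt0n.
split=> [r|r u v _ _|u v _ _ uv].
- by rewrite /avg sumr_const card_ord -[r *+ n]mulr_natr mulfK.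
- by rewrite /avg big_split /= -mulr_sumr mulrDl mulrA.
- by rewrite /avg ler_wpM2r ?invr_ge0 // ler_sum.
Qed.

(** Two windows that are shifts of each other differ only at their ends; the
    formula is symmetric in the length [n] and the shift [m]. *)
Lemma sum_shift (V : zmodType) (F : nat -> V) n m :
  \sum_(i < n) (F (i + m)%N - F i) = \sum_(i < m) (F (i + n)%N - F i).
Proof.
rewrite !sumrB; apply/eqP; rewrite subr_eq addrAC eq_sym subr_eq; apply/eqP.
rewrite addrC -[RHS]addrC.
have E k l : \sum_(i < k) F i + \sum_(i < l) F (i + k)%N = \sum_(i < k + l) F i.
  by rewrite big_split_ord; congr (_ + _); apply: eq_bigr => i _ /=; rewrite addnC.
by rewrite !E addnC.
Qed.

Lemma avg_shift n m (u : nat -> R) (B : R) : (0 < n)%N -> (forall i, `|u i| <= B) ->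
  `|avg n (fun i => u (i + m)%N) - avg n u| <= 2 * B * (m%:R / n%:R).
Proof.
move=> n0 uB; rewrite /avg -mulrBl -sumrB sum_shift mulrA normrM.
rewrite [X in _ * X <= _]ger0_norm ?invr_ge0 // ler_wpM2r ?invr_ge0 //.
rewrite (le_trans (ler_norm_sum _ _ _)) //.
rewrite (_ : _ * m%:R = \sum_(i < m) 2 * B); last by rewrite sumr_const card_ord mulr_natr.
apply: ler_sum => i _; rewrite (le_trans (ler_normB _ _)) // mulr2n mulrDl !mul1r.
exact: lerD.
Qed.

End Means.

(** * Amenability of the group *)

Section Amenability.
Variable R : realType.
Local Open Scope classical_set_scope.

Lemma avg_dist n (u v : nat -> R) (e : R) : (0 < n)%N ->
  (forall i, (i < n)%N -> `|u i - v i| <= e) -> `|avg n u - avg n v| <= e.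
Proof.
move=> n0 uv; have n0' : 0 < (n%:R : R) by rewrite ltr0n.
rewrite /avg -mulrBl -sumrB normrM normfV normr_nat ler_pdivrMr //.
rewrite (le_trans (ler_norm_sum _ _ _)) //.
rewrite (_ : e * n%:R = \sum_(i < n) e); last by rewrite sumr_const card_ord mulr_natr.
by apply: ler_sum => i _; exact: uv.
Qed.

Lemma avg_norm n (u : nat -> R) (B : R) : (0 < n)%N -> (forall i, `|u i| <= B) -> `|avg n u| <= B.
Proof. by move=> n0 uB; apply: (mean_norm (avg_is_mean R n0)). Qed.

(** The box has the proportions of a ball. With the powers of [b] first, right
    multiplication by either generator only increases exponents. *)
Definition box_mean (k : nat) (u : heis -> R) : R :=
  avg k (fun j => avg k (fun i => avg (k * k)
    (fun l => u (heis_b ^+ j * heis_a ^+ i * heis_c ^+ l)%g))).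

Lemma box_is_mean k : (0 < k)%N -> is_mean (box_mean k).
Proof.
move=> k0; have kk0 : (0 < k * k)%N by rewrite muln_gt0 k0.
have m := mean_pair (avg_is_mean R k0) (mean_pair (avg_is_mean R k0) (avg_is_mean R kk0)).
exact: (mean_image (fun v : nat * (nat * nat) =>
  heis_b ^+ v.1 * heis_a ^+ v.2.1 * heis_c ^+ v.2.2)%g m).
Qed.

Lemma box_mean_a k u (B : R) : (0 < k)%N -> (forall x, `|u x| <= B) ->
  `|box_mean k (fun x => u (x * heis_a)%g) - box_mean k u| <= 4 * B / k%:R.
Proof.
move=> k0 uB; have kk0 : (0 < k * k)%N by rewrite muln_gt0 k0.
have B0 : 0 <= B by exact: le_trans (uB 1%g).
apply: (@le_trans _ _ (2 * B * (1%:R / k%:R))); last first.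
  by rewrite mul1r ler_wpM2r ?invr_ge0 // ler_wpM2r // ler_nat.
apply: avg_dist => // j _.
pose v i := avg (k * k) (fun l => u (heis_b ^+ j * heis_a ^+ i * heis_c ^+ l)%g).
have -> : (fun i => avg (k * k)
    (fun l => u (heis_b ^+ j * heis_a ^+ i * heis_c ^+ l * heis_a)%g)) =
    (fun i => v (i + 1)%N).
  apply/funext => i; congr avg; apply/funext => l; congr u.
  by rewrite -mulgA heis_cX_central mulgA addn1 expgSr !mulgA.
by apply: avg_shift => // i; exact: avg_norm.
Qed.

(** Moving [b] past [a ^ i] costs [c ^ i], a shift that is short compared to the
    side [k ^ 2]. *)
Lemma box_mean_b k u (B : R) : (0 < k)%N -> (forall x, `|u x| <= B) ->
  `|box_mean k (fun x => u (x * heis_b)%g) - box_mean k u| <= 4 * B / k%:R.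
Proof.
move=> k0 uB; have kk0 : (0 < k * k)%N by rewrite muln_gt0 k0.
have B0 : 0 <= B by exact: le_trans (uB 1%g).
have k0' : 0 < (k%:R : R) by rewrite ltr0n.
pose v j i l := u (heis_b ^+ j * heis_a ^+ i * heis_c ^+ l)%g.
have -> : box_mean k (fun x => u (x * heis_b)%g) =
    avg k (fun j => avg k (fun i => avg (k * k) (fun l => v (j + 1) i (l + i))))%N.
  congr avg; apply/funext => j; congr avg; apply/funext => i.
  congr avg; apply/funext => l; congr u.
  rewrite -mulgA heis_cX_central -!mulgA [(heis_a ^+ i * _)%g]mulgA heis_aXbE.
  by rewrite heis_cX_central -!mulgA -expgnDr addn1 expgSr !mulgA [(i + l)%N]addnC.
pose mid : R := avg k (fun j => avg k (fun i => avg (k * k) (v (j + 1)%N i))).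
apply: (le_trans (ler_distD mid _ _)).
rewrite (_ : 4 * B / k%:R = 2 * B / k%:R + 2 * B * (1%:R / k%:R)); last by field; lra.
apply: lerD; last first.
  pose w j := avg k (fun i => avg (k * k) (v j i)).
  by apply: (@avg_shift _ _ _ w) => // j; do 2?[apply: avg_norm => // ?]; exact: uB.
apply: avg_dist => // j _; apply: avg_dist => // i ik.
apply: le_trans (_ : 2 * B * (i%:R / (k * k)%:R) <= _).
  by apply: (@avg_shift _ _ _ (v (j + 1)%N i)) => // l; exact: uB.
rewrite ler_wpM2l ?mulr_ge0 // natrM invfM mulrA.
by rewrite ler_piMl ?invr_ge0 // ler_pdivrMr // mul1r ler_nat ltnW.
Qed.

Lemma ultrafilter_preimage (T U : Type) (f : T -> U) (G : set_system T) :
  UltraFilter G -> UltraFilter (f @ G).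
Proof.
move=> GU; split; first exact: fmap_proper_filter.
move=> H HF GH; rewrite predeqE => A; split; last exact: GH.
move=> HA; have [//|GnA] := in_ultra_setVsetC (f @^-1` A) GU.
have /GH HnA : (f @ G) (~` A) by [].
by have [x []] := filter_ex (filterI HA HnA).
Qed.

Lemma ultrafilter_cvg (G : set_system nat) (v : nat -> R) (B : R) :
  UltraFilter G -> (forall k, `|v k| <= B) -> cvg (v k @[k --> G]).
Proof.
move=> GU vB; have := @segment_compact R (- B) B; rewrite compact_ultra.
move=> /(_ (v @ G) (ultrafilter_preimage _ GU)) [].
  by apply: (@filterE nat G) => k /=; rewrite in_itv /= -ler_norml.
by move=> l [_ vl]; apply/cvg_ex; exists l.
Qed.

(** Amenability: the boxes are almost invariant, and a limit along an
    ultrafilter makes the invariance exact. *)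
Theorem heis_invariant_mean : exists M : (heis -> R) -> R, is_mean M /\
  forall u g, bounded_real u -> M (fun x => u (x * g)%g) = M u.
Proof.
have [G [GU ooG]] := ultraFilterLemma (F := \oo) _.
pose M u := lim (box_mean k.+1 u @[k --> G]).
have cv u : bounded_real u -> cvg (box_mean k.+1 u @[k --> G]).
  by case=> B uB; apply: ultrafilter_cvg => k; exact: (mean_norm (box_is_mean (ltn0Sn k)) uB).
have mM : is_mean M.
  split=> [r|r u v bu bv|u v bu bv uv].
  - rewrite /M; under eq_fun do rewrite (mean_cst (box_is_mean _)) //.
    exact: lim_cst.
  - rewrite /M; under eq_fun do rewrite (mean_linear (box_is_mean _)) //.
    apply/cvg_lim => //; apply: cvgD; last exact: cv.
    by apply: cvgMr; exact: cv.
  - apply: ler_lim; [exact: cv..|].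
    by apply: filterE => k; exact: (mean_le (box_is_mean (ltn0Sn k)) bu bv uv).
exists M; split => // + g.
suff inv h : (forall k u (B : R), (0 < k)%N -> (forall x, `|u x| <= B) ->
    `|box_mean k (fun x => u (x * h)%g) - box_mean k u| <= 4 * B / k%:R) ->
    forall u, bounded_real u -> M (fun x => u (x * h)%g) = M u.
  elim/heis_genP: g => [||x y IHx IHy|x IHx] u bu.
  - by apply: inv => //; exact: box_mean_a.
  - by apply: inv => //; exact: box_mean_b.
  - rewrite -(IHy u bu) -(IHx (fun z => u (z * y)%g)); last exact: bounded_comp.
    by congr M; apply/funext => z; rewrite mulgA.
  - rewrite -(IHx (fun z => u (z * x^-1)%g)); last exact: bounded_comp.
    by congr M; apply/funext => z; rewrite mulgK.
move=> hinv u bu; apply/eqP; rewrite -subr_eq0; apply/eqP.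
have buh : bounded_real (fun x => u (x * h)%g) by exact: bounded_comp.
have [B uB] := bu.
have -> : M (fun x => u (x * h)%g) - M u =
    lim (box_mean k.+1 (fun x => u (x * h)%g) - box_mean k.+1 u @[k --> G]).
  by apply/esym/cvg_lim => //; apply: cvgB; exact: cv.
apply/cvg_lim => //; apply: norm_cvg0.
have c0 : 4 * B / k.+1%:R @[k --> G] --> (0 : R).
  rewrite -(mulr0 (4 * B)); apply: cvgMr.
  by apply: (cvg_trans _ (@cvg_harmonic R)); exact: (cvg_app _ ooG).
apply: squeeze_cvgr (cvg_cst 0) c0; apply: filterE => k.
by rewrite normr_ge0 /= hinv.
Qed.

End Amenability.

(** * Averages along the centre and uniform convexity *)

Section Smoothing.
Variables (R : realType) (X : normedModType R).

Definition vavg (n : nat) (F : nat -> X) : X := n%:R^-1 *: \sum_(i < n) F i.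

Lemma vavg_norm n F : `|vavg n F| <= avg n (fun i => `|F i|).
Proof.
rewrite /vavg /avg normrZ normfV normr_nat mulrC ler_wpM2r ?invr_ge0 //.
exact: ler_norm_sum.
Qed.

Lemma vavg_norm_le n F (B : R) : (0 < n)%N -> (forall i, (i < n)%N -> `|F i| <= B) ->
  `|vavg n F| <= B.
Proof.
move=> n0 FB; rewrite (le_trans (vavg_norm _ _)) // /avg ler_pdivrMr ?ltr0n //.
rewrite (_ : B * n%:R = \sum_(i < n) B); last by rewrite sumr_const card_ord mulr_natr.
by apply: ler_sum => i _; exact: FB.
Qed.

Lemma vavgB n F G : vavg n F - vavg n G = vavg n (fun i => F i - G i).
Proof. by rewrite /vavg -scalerBr sumrB. Qed.

Lemma vavg_cst n v : (0 < n)%N -> vavg n (fun=> v) = v.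
Proof.
move=> n0; rewrite /vavg sumr_const card_ord -[v *+ n]scaler_nat scalerA mulVf ?scale1r //.
by rewrite pnatr_eq0 -lt0n.
Qed.

Lemma sum_block (V : zmodType) (F : nat -> V) r N :
  \sum_(k < r * N) F k = \sum_(s < r) \sum_(l < N) F (s * N + l)%N.
Proof.
elim: r => [|r IH]; first by rewrite !big_ord0.
by rewrite mulSnr big_split_ord /= IH big_ord_recr.
Qed.

(** Testing the convexity inequality on each value against the average bounds the
    deviation from the average by the loss in the mean of [p]-th powers. *)
Lemma uniform_convexity_defect (p K : R) n F :
    1 < p -> 0 < K -> uniformly_p_convex p X K -> (0 < n)%N ->
    bounded_real (fun s => `|F s|) ->
  avg n (fun s => `|2^-1 *: (F s - vavg n F)| `^ p) <=
  K `^ p / 2 * (avg n (fun s => `|F s| `^ p) - `|vavg n F| `^ p).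
Proof.
move=> p1 K0 conv n0 [B FB]; set m := vavg n F; have mA := avg_is_mean R n0.
have B0 : 0 <= B by exact: le_trans (FB 0%N).
have p0 : 0 <= p by lra.
have nn x : `|2^-1 *: x : X| = 2^-1 * `|x| by rewrite normrZ gtr0_norm.
pose u s := `|2^-1 *: (F s + m)|; pose d s := `|2^-1 *: (F s - m)| `^ p.
pose e s := `|F s| `^ p.
have mB : `|m| <= B.
  by apply: vavg_norm_le => // i _; rewrite -[`|F i|]ger0_norm.
have {}FB s : `|F s| <= B by rewrite -[`|F s|]ger0_norm.
have bu : bounded_real u.
  apply: (@bounded_between _ _ _ B) => s; rewrite /u normr_ge0 nn /=.
  by have := ler_normD (F s) m; have := FB s; lra.
have pow_bounded w C : (forall s : nat, 0 <= w s <= C) ->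
    bounded_real (fun s => w s `^ p).
  move=> wC; apply: (@bounded_between _ _ _ (C `^ p)) => s.
  have /andP[w0 wC'] := wC s.
  by rewrite powR_ge0 ge0_ler_powR ?nnegrE // (le_trans w0).
have bup : bounded_real (fun s => u s `^ p).
  apply: (pow_bounded _ B) => s; rewrite /u normr_ge0 nn /=.
  by have := ler_normD (F s) m; have := FB s; lra.
have be : bounded_real e by apply: (pow_bounded _ B) => s; rewrite normr_ge0 FB.
have bd : bounded_real d.
  apply: (pow_bounded _ B) => s; rewrite normr_ge0 nn /=.
  by have := ler_normB (F s) m; have := FB s; lra.
(* The midpoints [(F s + m) / 2] have average [m] again, so Jensen's inequality
   bounds the left side of the convexity inequality from below. *)
have mu : `|m| <= avg n u.
  apply: le_trans (vavg_norm _ _).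
  rewrite (_ : vavg n (fun i => 2^-1 *: (F i + m)) = m) //.
  rewrite -[RHS](vavg_cst m n0) /vavg -scaler_sumr big_split /=.
  rewrite scalerA mulrC -scalerA scalerDr -/(vavg n F) -/m -/(vavg n (fun=> m)).
  by rewrite (vavg_cst m n0) -mulr2n -[m *+ 2]scaler_nat scalerA mulVf ?scale1r ?pnatr_eq0.
have mup : `|m| `^ p <= avg n (fun s => u s `^ p).
  apply: le_trans (mean_powR mA p1 bu _); last by move=> s; exact: normr_ge0.
  by rewrite ge0_ler_powR ?nnegrE // (le_trans _ mu).
have Kp0 : 0 < K `^ p by exact: powR_gt0.
have : avg n (fun s => (K `^ p)^-1 * d s + u s `^ p) <=
    avg n (fun s => 2^-1 * e s + `|m| `^ p / 2).
  apply: (mean_le mA).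
  - exact: bounded_lin.
  - by apply: bounded_lin => //; exact: bounded_cst.
  - by move=> s; have := conv (F s) m; rewrite -/(u s) -/(d s) -/(e s); lra.
rewrite !(mean_linear mA) //; last exact: bounded_cst.
rewrite (mean_cst mA) -/d -/e => h.
suff : (K `^ p)^-1 * avg n d <= 2^-1 * (avg n e - `|m| `^ p).
  by rewrite mulrC ler_pdivrMr // mulrC mulrA.
by lra.
Qed.

(** Averaging over the centre is the only smoothing that is needed: it commutes
    with all translations. *)
Definition smooth (N : nat) (f : heis -> X) (x : heis) : X :=
  vavg N (fun l => f (x * heis_c ^+ l)%g).

Lemma smooth_mul N r f x :
  smooth (r * N) f x = vavg r (fun s => smooth N f (x * heis_c ^+ (s * N))%g).
Proof.
rewrite /smooth /vavg natrM invfM -scalerA; congr (_ *: _).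
rewrite (sum_block (fun k => f (x * heis_c ^+ k)%g)) scaler_sumr.
apply: eq_bigr => s _; congr (_ *: _); apply: eq_bigr => l _.
by rewrite expgnDr mulgA.
Qed.

Lemma smooth_diff N f g x :
  smooth N (fun y => f (y * g)%g - f y) x = smooth N f (x * g)%g - smooth N f x.
Proof.
rewrite /smooth vavgB; congr vavg; apply/funext => l.
by rewrite -!mulgA heis_cX_central.
Qed.

Lemma smooth_norm N f (B : R) x : (0 < N)%N -> (forall y, `|f y| <= B) ->
  `|smooth N f x| <= B.
Proof. by move=> N0 fB; apply: vavg_norm_le. Qed.

(** The averages over two windows that differ by a shift [m] see only the [m]
    points at either end. *)
Lemma smooth_shift N m f (B : R) x : (0 < N)%N ->
    (forall y, `|f (y * heis_c ^+ N)%g - f y| <= B) ->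
  `|smooth N f (x * heis_c ^+ m)%g - smooth N f x| <= m%:R / N%:R * B.
Proof.
move=> N0 fB; rewrite /smooth vavgB.
pose F l := f (x * heis_c ^+ l)%g.
have -> : (fun l => f (x * heis_c ^+ m * heis_c ^+ l)%g - f (x * heis_c ^+ l)%g) =
    (fun l => F (l + m)%N - F l).
  by apply/funext => l; rewrite /F -mulgA -expgnDr addnC.
rewrite /vavg sum_shift normrZ normfV normr_nat mulrAC mulrC.
rewrite ler_wpM2r ?invr_ge0 // (le_trans (ler_norm_sum _ _ _)) //.
rewrite (_ : m%:R * B = \sum_(i < m) B); last by rewrite sumr_const card_ord mulr_natl.
by apply: ler_sum => i _; rewrite /F expgnDr mulgA.
Qed.

End Smoothing.

Section Energy.
Variables (R : realType) (X : normedModType R).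
Context (M : (heis -> R) -> R).
Hypothesis mM : is_mean M.
Hypothesis invM : forall (u : heis -> R) g, bounded_real u -> M (fun x => u (x * g)%g) = M u.

Lemma mean_avg n (u : heis -> nat -> R) : (forall i, bounded_real (u ^~ i)) ->
  M (fun x => avg n (u x)) = avg n (fun i => M (u ^~ i)).
Proof.
move=> bu.
have bs k : bounded_real (fun x => \sum_(i < k) u x i).
  elim: k => [|k IH]; first by under eq_fun do rewrite big_ord0; exact: bounded_cst.
  by under eq_fun do rewrite big_ord_recr /=; exact: bounded_add.
rewrite /avg; under eq_fun do rewrite mulrC.
rewrite (mean_scale mM) // mulrC; congr (_ / _).
elim: n => [|n IH].
  by under eq_fun do rewrite big_ord0; rewrite big_ord0 (mean_cst mM).
by under eq_fun do rewrite big_ord_recr /=; rewrite (mean_add mM (bs n) (bu n)) big_ord_recr /= IH.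
Qed.

Lemma powR_unit_interval (p t : R) : 0 <= p -> 0 <= t <= 1 -> 0 <= t `^ p <= 1.
Proof.
move=> p0 /andP[t0 t1]; rewrite powR_ge0 /=.
have : t `^ p <= 1 `^ p by rewrite ge0_ler_powR ?nnegrE.
by rewrite powR1.
Qed.

Definition energy (p : R) (phi : heis -> X) (N : nat) : R :=
  M (fun x => `|smooth N phi x| `^ p).

Lemma energy_bounds (p : R) phi N : 0 <= p -> (0 < N)%N -> (forall x, `|phi x| <= 1) ->
  0 <= energy p phi N <= 1.
Proof.
move=> p0 N0 phi1.
have h x : 0 <= `|smooth N phi x| `^ p <= 1.
  by apply: powR_unit_interval => //; rewrite normr_ge0; exact: smooth_norm.
have b := bounded_between h.
apply/andP; split; first by apply: (mean_ge0 mM) => // x; case/andP: (h x).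
rewrite -(mean_cst mM 1); apply: (mean_le mM) => //; first exact: bounded_cst.
by move=> x; case/andP: (h x).
Qed.

Section EnergyDrop.
Context (p K : R) (phi : heis -> X) (N r : nat).
Hypotheses (p1 : 1 < p) (K0 : 0 < K) (conv : uniformly_p_convex p X K).
Hypotheses (N0 : (0 < N)%N) (r0 : (0 < r)%N) (phi1 : forall x, `|phi x| <= 1).

Let F x s := smooth N phi (x * heis_c ^+ (s * N))%g.
Let v (z : heis * nat) := `|2^-1 *: (F z.1 z.2 - smooth (r * N) phi z.1)|.

Let rN0 : (0 < r * N)%N. Proof. by rewrite muln_gt0 r0. Qed.

Let sB k x : (0 < k)%N -> 0 <= `|smooth k phi x| <= 1.
Proof. by move=> ?; rewrite normr_ge0 smooth_norm. Qed.

Let pow1 (t : R) : 0 <= t <= 1 -> 0 <= t `^ p <= 1.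
Proof. by apply: powR_unit_interval; move: p1; lra. Qed.

Let v1 z : 0 <= v z <= 1.
Proof.
rewrite /v normr_ge0 normrZ gtr0_norm ?invr_gt0 //=.
have := ler_normB (F z.1 z.2) (smooth (r * N) phi z.1).
have /andP[_] := sB (z.1 * heis_c ^+ (z.2 * N))%g N0.
by have /andP[_] := sB z.1 rN0; rewrite /F; lra.
Qed.

(** Passing from windows of length [N] to windows of length [r * N] changes the
    smoothing of [phi] only as much as the energy drops. *)
Lemma energy_defect : M (fun x => avg r (fun s => v (x, s) `^ p)) <=
  K `^ p / 2 * (energy p phi N - energy p phi (r * N)).
Proof.
have bs k g : (0 < k)%N -> bounded_real (fun x => `|smooth k phi (x * g)%g| `^ p).
  by move=> k0; apply: (@bounded_between _ _ _ 1) => x; exact/pow1/sB.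
have bF : bounded_real (fun x => avg r (fun s => `|F x s| `^ p)).
  exists 1 => x; apply: avg_norm => // s; rewrite ger0_norm ?powR_ge0 //.
  by have /andP[] := pow1 (sB (x * heis_c ^+ (s * N))%g N0).
have bm : bounded_real (fun x => `|smooth (r * N) phi x| `^ p).
  by apply: (@bounded_between _ _ _ 1) => x; exact/pow1/sB.
have -> : energy p phi N = M (fun x => avg r (fun s => `|F x s| `^ p)).
  rewrite mean_avg; last by move=> s; exact: bs.
  rewrite -[LHS](mean_cst (avg_is_mean R r0)); congr avg; apply/funext => s.
  rewrite [RHS](invM (u := fun x => `|smooth N phi x| `^ p)) //.
  by apply: (@bounded_between _ _ _ 1) => x; exact/pow1/sB.
rewrite -(mean_scaleB mM) //; apply: (mean_le mM).
- exists 1 => x; apply: avg_norm => // s; rewrite ger0_norm ?powR_ge0 //.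
  by have /andP[] := pow1 (v1 (x, s)).
- have := bounded_lin (K `^ p / 2) bF (bounded_lin (- (K `^ p / 2)) bm (bounded_cst _ 0)).
  by congr bounded_real; apply/funext => x; ring.
- move=> x; rewrite /v /= !smooth_mul.
  apply: uniform_convexity_defect => //.
  by apply: (@bounded_between _ _ _ 1) => s; exact: sB.
Qed.

Lemma energy_le : energy p phi (r * N) <= energy p phi N.
Proof.
have Kp0 : 0 < K `^ p / 2 by rewrite divr_gt0 ?powR_gt0.
rewrite -subr_ge0 -(pmulr_rge0 _ Kp0); apply: le_trans energy_defect.
apply: (mean_ge0 mM); last first.
  by move=> x; rewrite /avg mulr_ge0 ?invr_ge0 // sumr_ge0 // => s _; exact: powR_ge0.
exists 1 => x; apply: avg_norm => // s; rewrite ger0_norm ?powR_ge0 //.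
by have /andP[] := pow1 (v1 (x, s)).
Qed.

Lemma energy_drop :
  M (fun x => avg r (fun s =>
    `|smooth N phi (x * heis_c ^+ (s * N))%g - smooth (r * N) phi x|)) <=
  2 * (K `^ p / 2 * (energy p phi N - energy p phi (r * N))) `^ p^-1.
Proof.
have p0 : 0 < p by move: p1; lra.
have mMM := mean_pair mM (avg_is_mean R r0).
have bv := bounded_between v1.
pose W := M (fun x => avg r (fun s => v (x, s))).
have -> : M (fun x => avg r (fun s => `|F x s - smooth (r * N) phi x|)) = 2 * W.
  rewrite -(mean_scale mMM) //; congr M; apply/funext => x; congr avg.
  by apply/funext => s; rewrite /v /= normrZ gtr0_norm ?invr_gt0 // mulrA divff ?mul1r.
rewrite ler_pM2l //.
have W0 : 0 <= W by apply: (mean_ge0 mMM) => // z; case/andP: (v1 z).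
have Wp : W `^ p <= K `^ p / 2 * (energy p phi N - energy p phi (r * N)).
  apply: le_trans energy_defect; apply: (mean_powR mMM) => // z.
  by case/andP: (v1 z).
have -> : W = (W `^ p) `^ p^-1 by rewrite -powRrM divff ?powRr1 // gt_eqF.
apply: ge0_ler_powR; rewrite ?nnegrE ?invr_ge0 ?powR_ge0 ?(ltW p0) //.
exact: le_trans (powR_ge0 _ _) Wp.
Qed.

End EnergyDrop.

End Energy.

(** * Comparison of two smoothings at one scale *)

Section MeanDisplacement.
Variable R : realType.
Context (M : (heis -> R) -> R).
Hypothesis mM : is_mean M.
Hypothesis invM : forall (u : heis -> R) g, bounded_real u -> M (fun x => u (x * g)%g) = M u.

Context (d : heis -> heis -> R).
Hypothesis d0 : forall x, d x x = 0.
Hypothesis dC : forall x y, d x y = d y x.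
Hypothesis dD : forall x y z, d x z <= d x y + d y z.
Hypothesis bd : forall g, bounded_real (fun x => d x (x * g)%g).

(** Invariance of the mean makes this a length function on the group. *)
Definition displacement (g : heis) : R := M (fun x => d x (x * g)%g).

Lemma displacement1 : displacement 1%g = 0.
Proof.
rewrite -(mean_cst mM 0) /displacement; congr M; apply/funext => x.
by rewrite mulg1 d0.
Qed.

Lemma displacementM g h : displacement (g * h)%g <= displacement g + displacement h.
Proof.
rewrite /displacement -(invM g (bd h)) -(mean_add mM); [|exact: bd|].
  apply: (mean_le mM); first exact: bd.
    by apply: bounded_add; [exact: bd|exact: (bounded_comp (fun x => x * g)%g (bd h))].
  by move=> x; rewrite mulgA; exact: dD.
exact: (bounded_comp (fun x => x * g)%g (bd h)).
Qed.

Lemma displacementV g : displacement g^-1%g = displacement g.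
Proof.
rewrite /displacement -(invM g (bd g^-1%g)); congr M; apply/funext => x.
by rewrite mulgK dC.
Qed.

Lemma displacementX g n : displacement (g ^+ n)%g <= n%:R * displacement g.
Proof.
elim: n => [|n IH]; first by rewrite expg0 displacement1 mul0r.
rewrite expgSr -natr1 mulrDl mul1r (le_trans (displacementM _ _)) //.
by rewrite lerD2r.
Qed.

Lemma displacement_cX n :
  displacement (heis_c ^+ (n * n))%g <=
  2 * n%:R * (displacement heis_a + displacement heis_b).
Proof.
rewrite heis_cX_comm.
set A := (heis_a ^+ n)%g; set B := (heis_b ^+ n)%g.
have := displacementM (A * B * A^-1)%g B^-1%g.
have := displacementM (A * B)%g A^-1%g; have := displacementM A B.
rewrite !displacementV; have := displacementX heis_a n; have := displacementX heis_b n.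
rewrite -/A -/B => ? ? ? ? h; apply: le_trans h _; lra.
Qed.

End MeanDisplacement.

Section OneScale.
Variables (R : realType) (X : normedModType R).
Context (M : (heis -> R) -> R).
Hypothesis mM : is_mean M.
Hypothesis invM : forall (u : heis -> R) g, bounded_real u -> M (fun x => u (x * g)%g) = M u.
Context (p K : R) (f : heis -> X).
Hypotheses (p1 : 1 < p) (K0 : 0 < K) (conv : uniformly_p_convex p X K).
Hypothesis fL : lipschitz1 f.

Definition increment (g x : heis) : X := f (x * g)%g - f x.

Lemma increment_norm g x : `|increment g x| <= (word_length g)%:R.
Proof. by rewrite distrC (le_trans (fL _ _)) // /dW mulKg. Qed.

Lemma increment_gen g x : g \in heis_gens -> `|increment g x| <= 1.
Proof.
by move=> /word_length_gen g1; rewrite (le_trans (increment_norm _ _)) // (ler_nat _ _ 1).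
Qed.

Lemma smooth_close u x : (0 < u)%N -> `|f x - smooth (u * u) f x| <= 6 * u%:R.
Proof.
move=> u0; have uu0 : (0 < u * u)%N by rewrite muln_gt0 u0.
rewrite -{1}(vavg_cst (f x) uu0) /smooth vavgB; apply: vavg_norm_le => // l lu.
rewrite distrC (le_trans (increment_norm _ _)) // -natrM ler_nat.
exact: word_length_cX_small.
Qed.

(** Smoothing at the scale [u] moves [f] by [O(u)], and after smoothing at the
    scale [D * D * u] the central element of scale [D * u] has displacement [O(u)].
    The difference of the two smoothings is therefore as large on that element as
    [f] itself; but it is displaced by the commutator word only as much as its
    increments along [a] and [b] allow, and convexity controls these. *)
Lemma one_scale u D (lambda : R) (n := (D * u)%N)
    (drop := fun g => energy M p (increment g) (u * u)
                      - energy M p (increment g) (D * D * u * (D * D * u))) :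
    (0 < u)%N -> (0 < D)%N ->
    (forall y, lambda <= `|increment (heis_c ^+ (n * n))%g y|) ->
  lambda <= 16 * u%:R + 4 * n%:R *
    ((K `^ p / 2 * drop heis_a) `^ p^-1 + (K `^ p / 2 * drop heis_b) `^ p^-1).
Proof.
move=> u0 D0 hl; set m := (n * n)%N in hl; set N := (u * u)%N in drop *.
pose r := (D * D * (D * D))%N.
have rN : (D * D * u * (D * D * u) = r * N)%N by rewrite /r /N; ring.
have N0 : (0 < N)%N by rewrite muln_gt0 u0.
have r0 : (0 < r)%N by rewrite !muln_gt0 D0.
have rN0 : (0 < r * N)%N by rewrite muln_gt0 r0.
have mr : is_mean (avg r) := avg_is_mean R r0.
pose Delta s z := smooth N f (z * heis_c ^+ (s * N))%g - smooth (r * N) f z.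
pose d x y := avg r (fun s => `|Delta s y - Delta s x|).
have DeltaE s g x : Delta s (x * g)%g - Delta s x =
    smooth N (increment g) (x * heis_c ^+ (s * N))%g - smooth (r * N) (increment g) x.
  rewrite /Delta !smooth_diff !opprD !opprK addrACA.
  by rewrite -[(x * g * _)%g]mulgA -(heis_cX_central (s * N) g) mulgA.
have dB s g x : `|Delta s (x * g)%g - Delta s x| <= 2 * (word_length g)%:R.
  rewrite DeltaE (le_trans (ler_normB _ _)) // mulr_natl mulr2n lerD //.
    by apply: smooth_norm => // y; exact: increment_norm.
  by apply: smooth_norm => // y; exact: increment_norm.
have bd g : bounded_real (fun x => d x (x * g)%g).
  exists (2 * (word_length g)%:R) => x; apply: avg_norm => // s.
  by rewrite normr_id.
(* [16 = 6 + 6 + 4]: two errors of smoothing [f] to [h_N], and the displacement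
   that is left in [h_N']. *)
have hc : lambda - 16 * u%:R <= displacement M d (heis_c ^+ m)%g.
  rewrite -(mean_cst mM (lambda - _)); apply: (mean_le mM) => //; first exact: bounded_cst.
  move=> x; rewrite -(mean_cst mr (lambda - _)); apply: (mean_le mr).
  - exact: bounded_cst.
  - by exists (2 * (word_length (heis_c ^+ m)%g)%:R) => s; rewrite normr_id.
  move=> s; set y := (x * heis_c ^+ (s * N))%g.
  have h1 := smooth_close (y * heis_c ^+ m)%g u0.
  have h2 := smooth_close y u0.
  have h3 : `|smooth (r * N) f (x * heis_c ^+ m)%g - smooth (r * N) f x| <= 4 * u%:R.
    have wc : ((word_length (heis_c ^+ (r * N))%g)%:R : R) <= 4 * (D * D * u)%:R.
      rewrite -natrM ler_nat -rN (leq_trans (word_length_cX _ _)) //; lia.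
    apply: le_trans (@smooth_shift _ _ _ m f (4 * (D * D * u)%:R) x rN0 _) _.
      by move=> z; exact: le_trans (increment_norm _ _) wc.
    rewrite -rN /m /n !natrM; have : (D%:R : R) != 0 by rewrite pnatr_eq0 -lt0n.
    have : (u%:R : R) != 0 by rewrite pnatr_eq0 -lt0n.
    by move=> ? ?; rewrite le_eqVlt; apply/orP; left; apply/eqP; field; apply/andP.
  have E : Delta s (x * heis_c ^+ m)%g - Delta s x =
      (smooth N f (y * heis_c ^+ m)%g - smooth N f y) -
      (smooth (r * N) f (x * heis_c ^+ m)%g - smooth (r * N) f x).
    by rewrite DeltaE !smooth_diff.
  have := hl y; rewrite /increment.
  set P := (y * heis_c ^+ m)%g in h1 E *.
  have -> : f P - f y = (f P - smooth N f P) - (f y - smooth N f y) +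
      (Delta s (x * heis_c ^+ m)%g - Delta s x) +
      (smooth (r * N) f (x * heis_c ^+ m)%g - smooth (r * N) f x).
    by rewrite E -addrA subrK opprB addrAC !subrKA.
  move=> h; have {h} := le_trans h (ler_normD _ _).
  have := ler_normD (f P - smooth N f P - (f y - smooth N f y)) (Delta s (x * heis_c ^+ m)%g - Delta s x).
  have := ler_normB (f P - smooth N f P) (f y - smooth N f y).
  rewrite -/N in h1 h2; lra.
have gen g : g \in heis_gens ->
    displacement M d g <= 2 * (K `^ p / 2 * drop g) `^ p^-1.
  move=> gg; rewrite /drop rN.
  apply: le_trans (energy_drop mM invM p1 K0 conv N0 r0 _); last first.
    by move=> x; exact: increment_gen.
  rewrite le_eqVlt; apply/orP; left; apply/eqP; congr M; apply/funext => x.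
  by congr avg; apply/funext => s; rewrite DeltaE.
have d0 x : d x x = 0.
  by rewrite -(mean_cst mr 0); congr avg; apply/funext => s; rewrite subrr normr0.
have dC x y : d x y = d y x.
  by congr avg; apply/funext => s; rewrite distrC.
have dD x y z : d x z <= d x y + d y z.
  rewrite /d /avg -mulrDl ler_wpM2r ?invr_ge0 // -big_split /=.
  by apply: ler_sum => s _; rewrite addrC; exact: ler_distD.
have := displacement_cX mM invM d0 dC dD bd n; rewrite -/m => hcm.
have ga : displacement M d heis_a <= 2 * (K `^ p / 2 * drop heis_a) `^ p^-1.
  by apply: gen; rewrite !inE eqxx.
have gb : displacement M d heis_b <= 2 * (K `^ p / 2 * drop heis_b) `^ p^-1.
  by apply: gen; rewrite !inE eqxx orbT.
rewrite -lerBlDl (le_trans hc) // (le_trans hcm) //.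
set A := (_ `^ _) in ga *; set B := (_ `^ _) in gb *.
rewrite (_ : 4 * n%:R * (A + B) = 2 * n%:R * (2 * A + 2 * B)); last by ring.
apply: ler_wpM2l; first by rewrite -natrM ler0n.
exact: lerD ga gb.
Qed.

End OneScale.

(** * Choice of a scale *)

Section MultiScale.
Variables (R : realType) (X : normedModType R).

Lemma compression_rate_le (f : heis -> X) y g :
  compression_rate f (word_length g) <= `|increment f g y|.
Proof.
apply: ge_inf; first by exists 0 => _ [x [z [_ ->]]].
by exists y, (y * g)%g; rewrite /dW mulKg distrC.
Qed.

Lemma pigeonhole_telescope (e : nat -> R) J (B : R) : (0 < J)%N ->
  e 0%N - e J <= B -> exists2 j, (j < J)%N & e j - e j.+1 <= B / J%:R.
Proof.
move=> J0 eB; apply: contrapT => no.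
have no' j : (j < J)%N -> B / J%:R < e j - e j.+1.
  by move=> jJ; rewrite ltNge; apply/negP => le; apply: no; exists j.
suff : B < e 0%N - e J by rewrite ltNge eB.
have -> : e 0%N - e J = \sum_(i < J) (e i - e i.+1).
  rewrite -opprB -(telescope_sumr e (leq0n J)) big_mkord -sumrN.
  by apply: eq_bigr => i _; rewrite opprB.
have -> : B = \sum_(i < J) B / J%:R.
  by rewrite sumr_const card_ord -[RHS]mulr_natr divfK // pnatr_eq0 -lt0n.
apply: ltr_sum => [|i _]; last exact: no'.
by apply/hasP; exists (Ordinal J0); rewrite ?mem_index_enum.
Qed.

(** Along the scales [D ^ (2 * j) * u0] the energies of the increments along [a]
    and [b] decrease and stay in [[0, 1]], so at one of [J] consecutive scales
    their total drop is at most [2 / J], and the inequality for that scale applies. *)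
Lemma multi_scale (p K : R) (f : heis -> X) u0 D J :
    1 < p -> 0 < K -> uniformly_p_convex p X K -> lipschitz1 f ->
    (0 < u0)%N -> (0 < D)%N -> (0 < J)%N ->
  exists2 j, (j < J)%N & let n := (D * (D ^ (2 * j) * u0))%N in
    compression_rate f (word_length (heis_c ^+ (n * n))%g) <=
    n%:R * (16 / D%:R + 8 * K * J%:R^-1 `^ p^-1).
Proof.
move=> p1 K0 conv fL u00 D0 J0; have p0 : 0 < p by lra.
have split_drop (e1 e2 e3 e4 q : R) : e1 + e2 - (e3 + e4) <= q -> e3 <= e1 -> e4 <= e2 ->
    e1 - e3 <= q /\ e2 - e4 <= q by lra.
have sum_roots (r1 r2 k q : R) : r1 <= k * q -> r2 <= k * q -> 4 * (r1 + r2) <= 8 * k * q.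
  by rewrite -mulrA; move: (k * q) => ?; lra.
have [M [mM invM]] := heis_invariant_mean R.
pose v j := (D ^ (2 * j) * u0)%N.
have v0 j : (0 < v j)%N by rewrite muln_gt0 expn_gt0 D0.
have vS j : v j.+1 = (D * D * v j)%N by rewrite /v mulnS expnD -mulnn mulnA.
have vv0 j : (0 < v j * v j)%N by rewrite muln_gt0 v0.
pose E g j := energy M p (increment f g) (v j * v j).
have E01 g j : g \in heis_gens -> 0 <= E g j <= 1.
  by move=> gg; apply: energy_bounds; rewrite ?(ltW p0) // => x; exact: increment_gen.
have Ele g j : g \in heis_gens -> E g j.+1 <= E g j.
  move=> gg; rewrite /E vS.
  have -> : (D * D * v j * (D * D * v j) = D * D * (D * D) * (v j * v j))%N by ring.
  apply: (energy_le mM invM p1 K0 conv) => //; first by rewrite !muln_gt0 D0.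
  by move=> x; exact: increment_gen.
have ga : heis_a \in heis_gens by rewrite !inE eqxx.
have gb : heis_b \in heis_gens by rewrite !inE eqxx orbT.
have [|j jJ Ej] := @pigeonhole_telescope (fun j => E heis_a j + E heis_b j) J 2 J0.
  have /andP[? ?] := E01 heis_a 0%N ga; have /andP[? ?] := E01 heis_b 0%N gb.
  have /andP[? ?] := E01 heis_a J ga; have /andP[? ?] := E01 heis_b J gb; lra.
exists j => //= ; rewrite -/(v j); set n := (D * v j)%N.
have root g : g \in heis_gens -> E g j - E g j.+1 <= 2 / J%:R ->
    (K `^ p / 2 * (E g j - E g j.+1)) `^ p^-1 <= K * J%:R^-1 `^ p^-1.
  move=> gg le; have -> : K * J%:R^-1 `^ p^-1 = (K `^ p / 2 * (2 / J%:R)) `^ p^-1.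
    rewrite mulrA divfK ?pnatr_eq0 // powRM ?powR_ge0 ?invr_ge0 //.
    by rewrite -powRrM divff ?powRr1 ?(ltW K0) // gt_eqF.
  have Kp : 0 <= K `^ p / 2 by rewrite divr_ge0 ?powR_ge0.
  apply: ge0_ler_powR; rewrite ?nnegrE ?invr_ge0 ?(ltW p0) //.
  - by rewrite mulr_ge0 // subr_ge0 Ele.
  - by apply: mulr_ge0 => //; rewrite divr_ge0.
  - by rewrite ler_wpM2l.
have := one_scale mM invM p1 K0 conv fL (v0 j) D0
  (fun y => compression_rate_le f y (heis_c ^+ (n * n))%g).
rewrite -/n -vS -/(E heis_a j) -/(E heis_b j) -/(E heis_a j.+1) -/(E heis_b j.+1).
move=> h; apply: (le_trans h).
have ra := root heis_a ga; have rb := root heis_b gb.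
have la := Ele heis_a j ga; have lb := Ele heis_b j gb.
have [da db] := split_drop _ _ _ _ _ Ej la lb.
have -> : 16 * (v j)%:R = n%:R * (16 / D%:R) :> R.
  by rewrite /n natrM; field; rewrite pnatr_eq0 -lt0n.
rewrite [leRHS]mulrDr lerD2l -[leLHS]mulrA mulrCA ler_wpM2l //.
exact: sum_roots _ _ _ _ (ra da) (rb db).
Qed.

End MultiScale.

(** * The convexity constant and logarithmic estimates *)

Section Nontriviality.
Variables (R : realType) (X : normedModType R).

Lemma Kp_ge0 (p : R) : (exists K : R, 0 < K /\ uniformly_p_convex p X K) -> 0 <= Kp p X.
Proof.
by move=> [K [K0 conv]]; apply: lb_le_inf; [exists K|move=> k [/ltW]].
Qed.

(** Antipodal points [v] and [- v] force the constant to be at least [1]. *)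
Lemma uniform_convexity_ge1 (p K : R) (v : X) : 0 < p -> v != 0 -> 0 < K ->
  uniformly_p_convex p X K -> 1 <= K.
Proof.
move=> p0 v0 K0 /(_ v (- v)).
rewrite subrr scaler0 normr0 powR0 ?gt_eqF // normrN opprK -[v + v]mulr2n -[v *+ 2]scaler_nat.
rewrite scalerA mulVf ?pnatr_eq0 // scale1r => h.
have V0 : 0 < `|v| `^ p by rewrite powR_gt0 // normr_gt0.
have K0' : 0 < K `^ p by exact: powR_gt0.
have {}h : 0 <= (1 - (K `^ p)^-1) * `|v| `^ p by lra.
have K1 : 1 <= K `^ p.
  by rewrite -invf_le1 // -subr_ge0 -(pmulr_lge0 _ V0).
rewrite leNgt; apply/negP => Klt.
have := gt0_ltr_powR p0 _ _ Klt; rewrite powR1 !nnegrE (ltW K0) ler01 => /(_ isT isT).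
by rewrite ltNge K1.
Qed.

(** The infimum is at least [1], so some admissible constant exceeds it by at most
    a factor of two. *)
Lemma Kp_attained_up_to_2 (p : R) (v : X) : 0 < p -> v != 0 ->
    (exists K : R, 0 < K /\ uniformly_p_convex p X K) ->
  exists K : R, [/\ 0 < K, uniformly_p_convex p X K, 1 <= Kp p X & K <= 2 * Kp p X].
Proof.
move=> p0 v0 [K [K0 conv]].
have lb : lbound [set K : R | 0 < K /\ uniformly_p_convex p X K]%classic 1.
  by move=> k [k0 kc]; exact: uniform_convexity_ge1 p0 v0 k0 kc.
have inf1 : 1 <= Kp p X by apply: lb_le_inf => //; exists K.
have hi : has_inf [set K : R | 0 < K /\ uniformly_p_convex p X K]%classic.
  by split; [exists K|exists 1].
have [k [k0 kc] klt] := inf_adherent ltr01 hi.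
by exists k; split => //; rewrite /Kp in inf1 *; lra.
Qed.

Lemma compression_rate_le_n (f : heis -> X) n (B : R) : 0 <= B ->
  (forall x y, dW x y = n -> `|f x - f y| <= B) -> compression_rate f n <= B.
Proof.
move=> B0 fB; rewrite /compression_rate; set S := (X in inf X).
have [->|/set0P[_ [x [y [xy _]]]]] := eqVneq S set0%classic; first by rewrite inf0.
apply: le_trans (fB _ _ xy); apply: ge_inf; last by exists x, y.
by exists 0 => _ [? [? [_ ->]]].
Qed.

End Nontriviality.

Section Logarithms.
Variable R : realType.
Implicit Types x y t : R.

Lemma ln_ge_1subV x : 0 < x -> 1 - x^-1 <= ln x.
Proof.
move=> x0; have xV0 : 0 < x^-1 by rewrite invr_gt0.
have := @le_ln1Dx R (x^-1 - 1); rewrite [1 + _]addrC subrK lnV ?posrE // => h.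
by have := h ltac:(lra); lra.
Qed.

Lemma ln_mono x y : 0 < x -> x <= y -> ln x <= ln y.
Proof. by move=> x0 xy; rewrite ler_ln ?posrE // (lt_le_trans x0). Qed.

Lemma ln3_gt1 : 1 < ln (3 : R).
Proof.
(* [1 - x^-1] is [1 / 6] at [x = 6 / 5], and the sixth power of [6 / 5] falls just
   short of [3]. *)
have e : (6 / 5) ^+ 6 < (3 : R) by rewrite !exprS expr0; lra.
have : ln ((6 / 5) ^+ 6) < ln (3 : R) by rewrite ltr_ln ?posrE ?exprn_gt0 //; lra.
rewrite lnXn; last lra.
have := @ln_ge_1subV (6 / 5); rewrite invf_div => /(_ _) h.
have {}h : 6^-1 <= ln (6 / 5 : R) by have := h ltac:(lra); lra.
by rewrite -[ln _ *+ 6]mulr_natr; lra.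
Qed.

(** From [ln s = 2 * ln (sqrt s) <= 2 * sqrt s] and [16 <= sqrt s]. *)
Lemma ln_small s : (256 : R) <= s -> 8 * ln s <= s.
Proof.
move=> s256; have s0 : 0 <= s by lra.
set q := Num.sqrt s; have sq : q ^+ 2 = s by rewrite sqr_sqrtr.
have q16 : 16 <= q.
  by rewrite -(@ler_pXn2r _ 2) ?nnegrE ?sqrtr_ge0 // sq -natrX; lra.
have q0 : 0 < q by lra.
rewrite -sq lnXn // mulr2n; have := ln_sublinear q0.
have : 16 * q <= q ^+ 2 by rewrite expr2 ler_pM2r.
lra.
Qed.

Definition loglog_ratio x : R := ln (ln x) / ln x.

Lemma loglog_ratio_ge t x : 3 <= t -> t <= x -> x <= t ^+ 2 ->
  ln (ln t) / (2 * ln t) <= loglog_ratio x.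
Proof.
move=> t3 tx xt; have lt1 : 1 < ln t.
  by apply: lt_le_trans ln3_gt1 _; apply: ln_mono; lra.
have lx : ln t <= ln x by apply: ln_mono; lra.
have lx2 : ln x <= 2 * ln t.
  have -> : 2 * ln t = ln (t ^+ 2) by rewrite lnXn ?mulr2n; lra.
  by apply: ln_mono; lra.
rewrite /loglog_ratio ler_pM ?ln_ge0 ?invr_ge0 //; try lra.
  by apply: ln_mono; lra.
by rewrite lef_pV2 ?posrE; lra.
Qed.

End Logarithms.

(** * Choice of the parameters and conclusion *)

Section Conclusion.
Variable R : realType.

Lemma expR_ln_pos (t : R) : 0 < t -> expR (ln t) = t.
Proof. by move=> t0; rewrite lnK ?posrE. Qed.

Lemma nat_just_above (x : R) : 0 <= x -> exists2 n : nat, (0 < n)%N & x <= n%:R <= x + 1.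
Proof.
move=> x0; exists (Num.truncn x).+1 => //.
have /andP[h1 h2] := truncn_itv x0.
by rewrite (ltW h2) /= -[_.+1%:R]natr1 lerD2r.
Qed.

(** The parameters of the multi-scale argument: the ratio of scales is a power of
    [D ~ ln t], which leaves room for [J ~ ln t / ln (ln t)] scales in [[t, t ^ 2]]. *)
Lemma scale_parameters (t : R) (s := ln t) : 3 <= t -> 256 <= s ->
  exists u0 D J : nat, [/\ [&& (0 < u0)%N, (0 < D)%N & (0 < J)%N],
    t <= u0%:R, s <= D%:R,
    J%:R^-1 <= 16 * (ln s / s) &
    forall j, (j < J)%N -> 4 * (D * (D ^ (2 * j) * u0))%:R <= t ^+ 2].
Proof.
move=> t3 s256; set sg := ln s.
have t0 : 0 < t by lra.
have s0 : 0 < s by lra.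
have sg1 : 1 < sg by apply: lt_le_trans (ln3_gt1 R) _; apply: ln_mono; lra.
have [u0 u00 /andP[tu ut]] : exists2 n : nat, (0 < n)%N & t <= n%:R <= t + 1.
  by apply: nat_just_above; lra.
have [D D0 /andP[sD Ds]] : exists2 n : nat, (0 < n)%N & s <= n%:R <= s + 1.
  by apply: nat_just_above; lra.
have q1 : 1 <= s / (8 * sg).
  by rewrite ler_pdivlMr ?mul1r; [exact: ln_small|lra].
have [J J1 J2] : exists2 J : nat, J%:R <= s / (8 * sg) & s / (8 * sg) < J%:R + 1.
  have /andP[? ?] := truncn_itv (le_trans ler01 q1).
  by exists (Num.truncn (s / (8 * sg))); rewrite ?natr1.
have J0 : (0 < J)%N by rewrite -(ltr0n R); lra.
have J0' : 1 <= (J%:R : R) by rewrite (ler_nat _ 1).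
exists u0, D, J; split => //; first by rewrite u00 D0.
- have sgs : 0 < sg / s by rewrite divr_gt0; lra.
  have w0 : 0 < 16 * (sg / s) by lra.
  rewrite -[leRHS]invrK lef_pV2 ?posrE ?invr_gt0 ?ltr0n //.
  have -> : (16 * (sg / s))^-1 = (s / (8 * sg)) / 2 by field; rewrite !gt_eqF //; lra.
  lra.
move=> j jJ.
have D0' : 1 <= (D%:R : R) by rewrite (ler_nat _ 1).
have lnD : ln (D%:R : R) <= 2 * sg.
  have -> : 2 * sg = ln (s ^+ 2) by rewrite lnXn // mulr_natl.
  apply: ln_mono; first lra.
  have : s * 2 <= s ^+ 2 by rewrite expr2 ler_pM2l //; lra.
  lra.
have powD : (D ^ (2 * J))%:R <= expR (s / 2).
  rewrite natrX -[D%:R]expR_ln_pos; last lra.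
  rewrite -expRM_natl ler_expR natrM.
  have : J%:R * (8 * sg) <= s by rewrite -ler_pdivlMr //; lra.
  have : J%:R * ln (D%:R : R) <= J%:R * (2 * sg) by rewrite ler_wpM2l.
  lra.
have DJ : (D * (D ^ (2 * j) * u0))%:R <= (D ^ (2 * J))%:R * u0%:R :> R.
  rewrite -natrM ler_nat mulnA -expnS leq_mul2r; apply/orP; right.
  by apply: leq_pexp2l => //; rewrite ltn_pmul2l.
have e8 : 8 <= expR (s / 2) by have := expR_ge1Dx (s / 2); lra.
have tE : t = expR (s / 2) * expR (s / 2) by rewrite -expRD -splitr expR_ln_pos.
have E0 := expR_ge0 (s / 2).
set e := expR (s / 2) in powD e8 tE E0.
have ee : e * (e * t) = t ^+ 2 by rewrite mulrA -tE expr2.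
have h1 : (D ^ (2 * J))%:R * u0%:R <= e * (2 * t) by rewrite ler_pM //; lra.
have h2 : 8 * (e * t) <= e * (e * t).
  by rewrite ler_wpM2r // mulr_ge0 // ltW.
rewrite -ee; apply: (le_trans _ h2); have := le_trans DJ h1.
by rewrite [e * (2 * t)]mulrCA; move: (e * t) => ?; lra.
Qed.

Section Large.
Variables (X : normedModType R) (p K : R) (f : heis -> X).
Hypotheses (p2 : 2 <= p) (K0 : 0 < K) (conv : uniformly_p_convex p X K).
Hypotheses (k1 : 1 <= Kp p X) (Kk : K <= 2 * Kp p X) (fL : lipschitz1 f).

(** The logarithmic ratio at [n] is compared with the one at [t], which is at most
    twice as large because [n <= t ^ 2]. *)
Lemma compression_large (t : R) : 3 <= t -> 256 <= ln t ->
  exists n : nat, t <= n%:R /\ n%:R <= t ^+ 2 /\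
    compression_rate f n / n%:R <= 544 * Kp p X * loglog_ratio n%:R `^ p^-1.
Proof.
move=> t3 s256; have p1 : 1 < p by apply: lt_le_trans p2; rewrite ltr1n.
have [KK kk1 Kpos] := And3 Kk k1 K0.
have ip : 0 <= p^-1 by rewrite invr_ge0 ltW // (lt_trans ltr01).
have ip1 : p^-1 <= 1 by rewrite invf_le1 ?(lt_trans ltr01) // ltW.
have [u0 [D [J [/and3P[u00 D0 J0] tu sD Jle nle]]]] := scale_parameters t3 s256.
have [j jJ /=] := multi_scale p1 K0 conv fL u00 D0 J0.
set n := (D * _)%N; set l := word_length _ => comp.
have nl : (n <= l)%N by exact: word_length_cX_ge.
have ln4 : (l <= 4 * n)%N by apply: leq_trans (word_length_cX n n) _; lia.
have un : (u0 <= n)%N.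
  by rewrite /n mulnA leq_pmull // muln_gt0 D0 expn_gt0 D0.
have tl : t <= l%:R by apply: le_trans tu _; rewrite ler_nat (leq_trans un).
have lt2 : l%:R <= t ^+ 2.
  by apply: le_trans (nle j jJ); rewrite -natrM ler_nat.
exists l; do 2?[split => //].
set s := ln t in s256 sD Jle *.
have sg1 : 1 < ln s by apply: lt_le_trans (ln3_gt1 R) _; apply: ln_mono; lra.
pose w := ln s / s.
have w0 : 0 < w by rewrite divr_gt0; lra.
have w1 : w <= 1 by rewrite ler_pdivrMr ?mul1r; [apply/ltW/ln_sublinear|]; lra.
have wp : w <= w `^ p^-1 by apply: ger1_powR => //; rewrite w0.
have sw : s^-1 <= w by rewrite /w ler_peMl ?invr_ge0; lra.
have D0' : 0 < (D%:R : R) by rewrite ltr0n.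
have s0 : 0 < s by lra.
have Dw : D%:R^-1 <= w `^ p^-1.
  apply: le_trans wp; apply: le_trans sw; by rewrite lef_pV2 ?posrE.
have c_powR (c x : R) : 1 <= c -> 0 <= x -> (c * x) `^ p^-1 <= c * x `^ p^-1.
  move=> c1 x0; rewrite powRM ?ler_wpM2r ?powR_ge0 //; last lra.
  exact: ler1_powR.
have Jw : J%:R^-1 `^ p^-1 <= 16 * w `^ p^-1.
  apply: le_trans (c_powR 16 w _ (ltW w0)); last lra.
  by apply: ge0_ler_powR => //; rewrite nnegrE; [rewrite invr_ge0|apply: mulr_ge0 => //; exact: ltW].
have rw : w <= 2 * loglog_ratio l%:R.
  have := loglog_ratio_ge t3 tl lt2; rewrite -/s.
  have -> : ln s / (2 * s) = w / 2 by rewrite /w; field; rewrite gt_eqF //; lra.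
  lra.
have r0 : 0 <= loglog_ratio (l%:R : R) by lra.
have Wr : w `^ p^-1 <= 2 * loglog_ratio l%:R `^ p^-1.
  apply: le_trans (c_powR 2 _ _ r0); last lra.
  by apply: ge0_ler_powR => //; rewrite nnegrE; [exact: ltW|apply: mulr_ge0].
set W := w `^ p^-1 in wp Dw Jw Wr; set Lr := _ `^ _ in Wr *.
have l0 : 0 < (l%:R : R) by apply: lt_le_trans tl; lra.
have W0 : 0 <= W by exact: powR_ge0.
(* [272 = 16 + 8 * 2 * 16]: the factor [2] is the loss in [K], the factor [16] the
   loss in [J]. *)
have Q : 16 / D%:R + 8 * K * J%:R^-1 `^ p^-1 <= 272 * Kp p X * W.
  have h1 : 16 / D%:R <= 16 * (Kp p X * W).
    rewrite ler_pM2l //; apply: (le_trans Dw).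
    by rewrite ler_peMl.
  have h2 : 8 * K * J%:R^-1 `^ p^-1 <= 8 * (2 * Kp p X) * (16 * W).
    by rewrite ler_pM ?powR_ge0 //; lra.
  rewrite (_ : 272 * Kp p X * W = 16 * (Kp p X * W) + 8 * (2 * Kp p X) * (16 * W)).
    exact: lerD h1 h2.
  by ring.
rewrite ler_pdivrMr //; apply: (le_trans comp); rewrite mulrC.
apply: ler_pM; rewrite ?ler0n ?ler_nat //.
  by rewrite addr_ge0 ?divr_ge0 // mulr_ge0 ?powR_ge0 // mulr_ge0 // ltW.
apply: (le_trans Q).
have -> : 544 * Kp p X * Lr = 272 * Kp p X * (2 * Lr) by ring.
by rewrite ler_wpM2l // mulr_ge0 //; lra.
Qed.

End Large.

End Conclusion.

Theorem theorem1p2 (R : realType) :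
  exists A : R, 0 < A /\
    forall (p : R) (X : completeNormedModType R) (f : heis -> X),
      2 <= p ->
      (exists K : R, 0 < K /\ uniformly_p_convex p X K) ->
      lipschitz1 f ->
      forall t : R, 3 <= t ->
        exists n : nat, t <= n%:R /\ n%:R <= t ^+ 2 /\
          compression_rate f n / n%:R <=
            A * Kp p X * (ln (ln n%:R) / ln n%:R) `^ p^-1.
Proof.
have ln3 := ln3_gt1 R.
have kappa0 : 0 < ln (ln 3) / 512 :> R by rewrite divr_gt0 ?ltr0n ?ln_gt0.
(* A lower bound for the logarithmic ratio when [ln t < 256]. *)
set kappa := ln (ln 3) / 512 in kappa0.
have kV0 : 0 < kappa^-1 by rewrite invr_gt0.
have [A [A544 Akappa]] : exists A : R, 544 <= A /\ kappa^-1 <= A.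
  by exists (544 + kappa^-1); split; lra.
have A0 : 0 < A by lra.
exists A; split => //.
move=> p X f p2 conv fL t t3.
have p0 : 0 < p by lra.
have K0 := Kp_ge0 conv.
have rhs0 n : 0 <= A * Kp p X * (ln (ln n%:R) / ln n%:R) `^ p^-1.
  exact: mulr_ge0 (mulr_ge0 (ltW A0) K0) (powR_ge0 _ _).
have [n n0 /andP[tn nt]] : exists2 n : nat, (0 < n)%N & t <= n%:R <= t + 1.
  by apply: nat_just_above; lra.
have nt2 : n%:R <= t ^+ 2.
  have : 3 * t <= t ^+ 2 by rewrite expr2 ler_pM2r; lra.
  lra.
have n0' : 0 < (n%:R : R) by rewrite ltr0n.
have [[v v0]|triv] := pselect (exists v : X, v != 0); last first.
  exists n; do 2?[split => //]; apply: le_trans (rhs0 n).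
  rewrite ler_pdivrMr // mul0r; apply: compression_rate_le_n => // x y _.
  have zero (w : X) : w = 0.
    by apply: contrapT => w0; apply: triv; exists w; exact/eqP.
  by rewrite (zero (f x)) (zero (f y)) subrr normr0.
have [K [Kpos Kc k1 Kk]] := Kp_attained_up_to_2 p0 v0 conv.
have [s256|s256] := lerP 256 (ln t).
  have [m [tm [mt cm]]] := compression_large p2 Kpos Kc k1 Kk fL t3 s256.
  exists m; do 2?[split => //]; apply: (le_trans cm).
  apply: ler_wpM2r; first exact: powR_ge0.
  exact: (ler_wpM2r K0).
(* For bounded [t] the logarithmic factor is bounded below and the Lipschitz
   bound on the compression rate is enough. *)
exists n; do 2?[split => //].
have rk : kappa <= loglog_ratio n%:R.
  have lt1 : ln 3 <= ln t by apply: ln_mono.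
  apply: le_trans (loglog_ratio_ge t3 tn nt2).
  apply: ler_pM.
  - by rewrite ln_ge0 ?(ltW ln3).
  - by rewrite invr_ge0 ler0n.
  - by apply: ln_mono lt1; apply: lt_trans ln3.
  - by rewrite lef_pV2 ?posrE ?ltr0n //; lra.
have kappa1 : kappa <= 1.
  by have := ln_sublinear (lt_trans ltr01 ln3); have := @ln_sublinear R 3; rewrite /kappa; lra.
have ip1 : p^-1 <= 1 by rewrite invf_le1 //; lra.
have kp : kappa <= loglog_ratio n%:R `^ p^-1.
  apply: (@le_trans _ _ (kappa `^ p^-1)).
    by apply: ger1_powR => //; rewrite kappa0.
  by apply: ge0_ler_powR; rewrite ?nnegrE ?invr_ge0 //; lra.
rewrite ler_pdivrMr //.
apply: (@le_trans _ _ n%:R).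
  by apply: compression_rate_le_n => // x y <-; exact: fL.
rewrite -[leLHS]mul1r ler_wpM2r //.
apply: (@le_trans _ _ (kappa^-1 * 1 * kappa)); first by rewrite mulr1 mulVf // gt_eqF.
rewrite -/(loglog_ratio _); apply: ler_pM; rewrite ?mulr1 ?(ltW kappa0) ?(ltW kV0) //.
by rewrite -[kappa^-1]mulr1; apply: ler_pM; rewrite ?ler01 ?(ltW kV0).
Qed.
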